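(* Let $d \ge 3$ be an integer, let $q$ be a prime power, and let $\mathcal{S}$ be one of the dual polar spaces $\mathsf{DQ}(2d,q)$, $\mathsf{DW}(2d-1,q)$, $\mathsf{DH}(2d-1,q^2)$. Then every nontrivial $m$-ovoid of $\mathcal{S}$ is a hemisystem; that is, if $\mathcal{S}$ has a nontrivial $m$-ovoid, then $m = (q+1)/2$.
   Context: Dual polar spaces. Given a finite polar space of rank $d$ arising from a form on a vector space $V$, its dual polar space is the point-line geometry whose points are the maximal totally isotropic (totally singular, in the quadratic case) subspaces of $V$ (vector space dimension $d$), whose lines are the next-to-maximal ones (totally isotropic or totally singular subspaces of vector space dimension $d-1$), and where a point is incident with a line if the corresponding $d$-dimensional subspace contains the corresponding $(d-1)$-dimensional subspace. $\mathsf{DQ}(2d,q)$ is the dual polar space of the parabolic quadric $\mathsf{Q}(2d,q)$, defined by a nondegenerate (nonsingular) quadratic form on $V=\mathbb{F}_q^{2d+1}$, using totally singular subspaces. $\mathsf{DW}(2d-1,q)$ is the dual polar space of the symplectic space $\mathsf{W}(2d-1,q)$, defined by a nondegenerate alternating form on $V=\mathbb{F}_q^{2d}$. $\mathsf{DH}(2d-1,q^2)$ is the dual polar space of the Hermitian variety $\mathsf{H}(2d-1,q^2)$, defined by a nondegenerate Hermitian form on $V=\mathbb{F}_{q^2}^{2d}$. In each of these three geometries every line is incident with exactly $q+1$ points. An $m$-ovoid of such a geometry is a set $\mathcal{O}$ of points such that every line is incident with exactly $m$ points of $\mathcal{O}$. The trivial $m$-ovoids are the empty set ($m=0$) and the set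 of all points ($m$ equal to the number $q+1$ of points on a line); all others are nontrivial. A hemisystem is an $m$-ovoid for which $m$ is exactly half of the number of points on a line. *)

(* Defs.v *)
From HB Require Import structures.
From mathcomp Require Import all_boot all_order all_algebra all_field.

Set Implicit Arguments.
Unset Strict Implicit.
Unset Printing Implicit Defensive.

Import GRing.Theory.
Local Open Scope ring_scope.

Section VspaceFinite.
Import VectorInternalTheory.
Variables (F : finFieldType) (V : vectType F).
HB.instance Definition _ := [Countable of {vspace V} by <:].
HB.instance Definition _ := [Finite of {vspace V} by <:].
End VspaceFinite.

Record geometry := Geometry {
  point : finType;
  line : finType;
  incident : point -> line -> bool
}.

Section Ovoids.
Variable S : geometry.

Definition points_on (L : line S) : {set point S} := [set x | incident x L].

Definition is_ovoid (m : nat) (O : {set point S}) : Prop :=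
  forall L : line S, #|O :&: points_on L| = m.

Definition nontrivial (O : {set point S}) : Prop := O <> set0 /\ O <> setT.

Definition hemisystem (O : {set point S}) : Prop :=
  exists2 m : nat, is_ovoid m O
    & forall L : line S, (2 * m)%N = #|points_on L|.

End Ovoids.

Section DualPolar.
Variables (F : finFieldType) (V : vectType F).
(* The family of totally isotropic (or totally singular) subspaces. *)
Variable isotropic : pred {vspace V}.

Definition maximal_isotropic (U : {vspace V}) : bool :=
  isotropic U &&
  [forall W : {vspace V}, isotropic W && (U <= W)%VS ==> (W == U)].

Definition dual_polar_space (d : nat) : geometry :=
  @Geometry {U : {vspace V} | maximal_isotropic U && (\dim U == d)}
            {L : {vspace V} | isotropic L && (\dim L == d.-1)}
            (fun U L => (val L <= val U)%VS).

End DualPolar.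

Section Quadratic.
Variables (F : finFieldType) (n : nat).
Local Notation V := 'rV[F]_n.

Definition polar (Q : V -> F) (u v : V) : F := Q (u + v) - Q u - Q v.

Definition quadratic_form (Q : V -> F) : Prop :=
  (forall (a : F) (v : V), Q (a *: v) = a ^+ 2 * Q v)
  /\ bilinear_for *%R *%R (polar Q).

(* In characteristic 2 and odd dimension the polar form is always degenerate,
   so nonsingularity only asks that Q have no nonzero zero in its radical. *)
Definition nonsingular (Q : V -> F) : Prop :=
  forall v : V, Q v = 0 -> (forall u : V, polar Q v u = 0) -> v = 0.

Definition totally_singular (Q : V -> F) (U : {vspace V}) : bool :=
  [forall u in U, Q u == 0].

End Quadratic.

Definition totally_isotropic (F : finFieldType) (V : vectType F) (eps : bool)
    (theta : {rmorphism F -> F}) (B : {hermitian V for eps & theta})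
    (U : {vspace V}) : bool :=
  (U <= orthov B U)%VS.

Definition prime_power (q : nat) : Prop :=
  exists p k : nat, [/\ prime p, (0 < k)%N & q = (p ^ k)%N].

(* Every alternating bilinear form is skew-symmetric, so requiring B u u = 0 of
   a skew-symmetric B covers exactly the alternating forms, in every
   characteristic. *)
Inductive DQ_DW_DH (d q : nat) : geometry -> Prop :=
| DQ (F : finFieldType) (Q : 'rV[F]_(2 * d + 1) -> F) :
    #|F| = q -> quadratic_form Q -> nonsingular Q ->
    DQ_DW_DH d q (dual_polar_space (totally_singular Q) d)
| DW (F : finFieldType) (B : {hermitian 'rV[F]_(2 * d) for true & idfun}) :
    #|F| = q -> nondegenerate B -> (forall u, B u u = 0) ->
    DQ_DW_DH d q (dual_polar_space (totally_isotropic B) d)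
| DH (F : finFieldType) (theta : {rmorphism F -> F})
     (B : {hermitian 'rV[F]_(2 * d) for false & theta}) :
    #|F| = (q ^ 2)%N -> (forall x, theta x = x ^+ q) -> nondegenerate B ->
    DQ_DW_DH d q (dual_polar_space (totally_isotropic B) d).

(* Main.v *)
(** Write d(x, y) = d - dim (x :&: y) for the distance of two points and let
    M x y = (-1/q) ^ d(x, y).  Each line L has a unique point nearest to x and its q
    other points are one step further, so the columns of M lie in the space K of
    functions that sum to 0 on every line; counting the lines through y that
    point towards x shows conversely that M acts on K as a nonzero scalar c, so M / c is
    the projector onto K.  The numbers of vertices of the spheres are q-binomial, and by the
    q-binomial theorem \sum_y M x y ^ 3 = \prod_(j < d) (1 - Q ^ j / q ^ 2), where
    Q is the order of the field.  This vanishes as q ^ 2 = Q ^ k for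
    some k < d (k = 2 for DQ and DW, k = 1 for DH), which is the extremal case of
    a Krein condition and forces \sum_x v x ^ 3 = 0 for all v in K.  If O is
    an m-ovoid and r = m / (q + 1), the function 1_O - r is in K, and
    \sum v = \sum v ^ 3 = 0 gives r = 0, r = 1 or r = 1 / 2. *)

Require Import Defs.
From HB Require Import structures.
From mathcomp Require Import all_boot all_order all_algebra all_field.
From mathcomp Require Import ring zify.

Set Implicit Arguments.
Unset Strict Implicit.
Unset Printing Implicit Defensive.

Import Order.TTheory GRing.Theory Num.Theory.
Local Open Scope ring_scope.

(** * The Krein-type cubic identity *)

Lemma cube_sum (R : comNzRingType) (I : finType) (F : I -> R) :
  (\sum_i F i) ^+ 3 = \sum_(p : I * I * I) F p.1.1 * F p.1.2 * F p.2.
Proof.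
rewrite -(pair_bigA _ (fun p k => F p.1 * F p.2 * F k)) /=.
under [RHS]eq_bigr => p _ do rewrite -mulr_sumr.
rewrite -mulr_suml -(pair_bigA _ (fun i j => F i * F j)) /=.
under [X in _ = X * _]eq_bigr => i _ do rewrite -mulr_sumr.
by rewrite -mulr_suml; ring.
Qed.

(* A Krein-type argument: the squares of the triple products of columns of [M]
   add up to [c ^+ 3 * \sum_x \sum_y M x y ^+ 3]. *)
Lemma cubic_sum_eq0 (R : realFieldType) (X : finType) (M : X -> X -> R) (c : R)
    (v : X -> R) :
    c != 0 ->
    (forall x y, \sum_z M x z * M y z = c * M x y) ->
    (forall x, \sum_y M x y ^+ 3 = 0) ->
    (forall x, \sum_y M x y * v y = c * v x) ->
  \sum_x v x ^+ 3 = 0.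
Proof.
move=> c0 MM M3 Mv.
pose T (p : X * X * X) := \sum_z M z p.1.1 * M z p.1.2 * M z p.2.
have T0 p : T p = 0.
  apply/eqP; rewrite -sqrf_eq0; apply/eqP.
  have : \sum_p T p ^+ 2 == 0.
    (* Expand the square over pairs [(x, y)] and sum over [p] first: each pair contributes the cube
       of the inner product of rows [x] and [y], a multiple of [M x y ^+ 3]. *)
    have -> : \sum_p T p ^+ 2 = \sum_x \sum_y (\sum_z M x z * M y z) ^+ 3.
      under eq_bigr => p0 _ do rewrite expr2 big_distrlr /=.
      rewrite exchange_big; apply: eq_bigr => x _ /=.
      rewrite exchange_big; apply: eq_bigr => y _ /=.
      by rewrite cube_sum; apply: eq_bigr => p0 _; ring.
    apply/eqP; apply: big1 => x _.
    under eq_bigr => y _ do rewrite MM exprMn.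
    by rewrite -mulr_sumr M3 mulr0.
  rewrite psumr_eq0; last by move=> p0 _; apply: sqr_ge0.
  by move=> /allP /(_ p); rewrite mem_index_enum => /(_ isT)/eqP.
have : c ^+ 3 * (\sum_x v x ^+ 3) = 0.
  rewrite mulr_sumr.
  under eq_bigr => x _ do rewrite -exprMn -Mv cube_sum.
  rewrite exchange_big big1 // => p _ /=.
  transitivity (v p.1.1 * v p.1.2 * v p.2 * T p).
    by rewrite /T mulr_sumr; apply: eq_bigr => z _; ring.
  by rewrite T0 mulr0.
by move/eqP; rewrite mulf_eq0 expf_eq0 /= (negPf c0) /= => /eqP.
Qed.

(** * Near polygons: distance eigenfunctions and the ovoid equation *)

Section NearPolygon.
(* [ldist x L] is the distance from [x] to the nearest point of the line [L];
   [q.+1] is the number of points on a line and [Q] the order of the field. *)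
Variables (R : realFieldType) (X Y : finType) (I : X -> Y -> bool).
Variables (dist : X -> X -> nat) (ldist : X -> Y -> nat) (d q Q k : nat).
Hypothesis q_gt0 : (0 < q)%N.
Hypothesis Q_gt1 : (1 < Q)%N.
Hypothesis dist0 : forall x y, (dist x y == 0%N) = (x == y).
Hypothesis distC : forall x y, dist x y = dist y x.
Hypothesis dist_le : forall x y, (dist x y <= d)%N.
Hypothesis line_size : forall L, #|[set x | I x L]| = q.+1.
Hypothesis dist_line : forall x y L, I y L ->
  dist x y = ldist x L \/ dist x y = (ldist x L).+1.
Hypothesis nearest : forall x L,
  #|[set y | I y L & dist x y == ldist x L]| = 1%N.
Hypothesis lines_on : forall y, ((Q - 1) * #|[set L | I y L]| = Q ^ d - 1)%N.
Hypothesis lines_towards : forall x y,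
  ((Q - 1) * #|[set L | I y L & dist x y == (ldist x L).+1]| = Q ^ dist x y - 1)%N.
Hypothesis k_lt_d : (k < d)%N.
Hypothesis q2E : (q ^ 2 = Q ^ k)%N.

Let Qr : R := Q%:R.
Let qr : R := q%:R.

Definition line_kernel (v : X -> R) := forall L, \sum_(y | I y L) v y = 0.

(* Sum [f (ldist x L) * v y] over all flags [(y, L)] in both orders. *)
Lemma near_flag_sum (v : X -> R) (f : nat -> R) x : line_kernel v ->
  \sum_y v y * ((Qr ^+ dist x y - 1) * f (dist x y).-1
                + (Qr ^+ d - Qr ^+ dist x y) * f (dist x y)) = 0.
Proof.
move=> kv.
transitivity ((Qr - 1) * \sum_L f (ldist x L) * \sum_(y | I y L) v y); last first.
  by rewrite big1 ?mulr0 // => L _; rewrite kv mulr0.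
under [X in _ = _ * X]eq_bigr => L _ do rewrite mulr_sumr big_mkcond /=.
rewrite exchange_big mulr_sumr; apply: eq_bigr => y _ /=.
(* With [i = dist x y], a line [L] on [y] either points towards [x] ([ldist x L] is [i.-1]) or has
   [y] as a nearest point ([ldist x L] is [i]). No line is of the first kind if [i = 0], so the
   default [0.-1 = 0] does no harm. *)
rewrite -big_mkcond /= (bigID (fun L => dist x y == (ldist x L).+1)) /=.
set i := dist x y.
have E1 : \sum_(L | I y L && (i == (ldist x L).+1)) f (ldist x L) * v y
    = #|[set L | I y L & i == (ldist x L).+1]|%:R * (f i.-1 * v y).
  rewrite -sum1_card natr_sum mulr_suml; apply: eq_big => [L|L /andP[_ /eqP ->]].
    by rewrite inE.
  by rewrite mul1r.
have E2 : \sum_(L | I y L && (i != (ldist x L).+1)) f (ldist x L) * v y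
    = #|[set L | I y L & i != (ldist x L).+1]|%:R * (f i * v y).
  rewrite -sum1_card natr_sum mulr_suml; apply: eq_big => [L|L /andP[yL ni]].
    by rewrite inE.
  case: (dist_line x yL) => E; first by rewrite /i E mul1r.
  by rewrite /i E eqxx in ni.
have Qr1 : (Q - 1)%:R = Qr - 1 by rewrite natrB // ltnW.
have QX n : (Q ^ n - 1)%:R = Qr ^+ n - 1.
  by rewrite natrB ?natrX // expn_gt0 ltnW.
have C1 := congr1 (fun n => n%:R : R) (lines_towards x y).
have C2 := congr1 (fun n => n%:R : R) (lines_on y).
rewrite -/i !natrM !Qr1 !QX in C1 C2.
have C3 : #|[set L | I y L]| = (#|[set L | I y L & i == (ldist x L).+1]| +
    #|[set L | I y L & i != (ldist x L).+1]|)%N.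
  rewrite -(cardsID [set L | i == (ldist x L).+1]).
  by congr (_ + _)%N; apply: eq_card => L; rewrite !inE // andbC.
rewrite {}C3 natrD in C2.
have -> : Qr ^+ d - Qr ^+ i = (Qr ^+ d - 1) - (Qr ^+ i - 1) by ring.
by rewrite E1 E2 -C2 -C1; ring.
Qed.

(** In closed form [(-1)^i Q^(i(i-1)/2)] times the Gaussian binomial of [d] over [i]. The recursion
    is [near_flag_sum] for the indicator of [j], which sees only the spheres of radius [j] and
    [j.+1]. *)
Fixpoint sphere_coef (i : nat) : R :=
  if i is j.+1 then
    - (Qr ^+ d - Qr ^+ j) / (Qr ^+ j.+1 - 1) * sphere_coef j
  else 1.

Lemma Qr_X_neq1 i : Qr ^+ i.+1 - 1 != 0.
Proof.
by rewrite subr_eq0 -natrX pnatr_eq1 -(expn0 Q) eqn_exp2l.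
Qed.

Lemma sphere_sum (v : X -> R) x i : line_kernel v ->
  \sum_(y | dist x y == i) v y = sphere_coef i * v x.
Proof.
move=> kv; elim: i => [|i IH] /=.
  by rewrite (big_pred1 x) ?mul1r // => y; rewrite dist0 eq_sym.
have := near_flag_sum (fun j => (j == i)%:R) x kv.
have -> : \sum_y v y * ((Qr ^+ dist x y - 1) * ((dist x y).-1 == i)%:R +
    (Qr ^+ d - Qr ^+ dist x y) * (dist x y == i)%:R)
   = (Qr ^+ i.+1 - 1) * (\sum_(y | dist x y == i.+1) v y)
     + (Qr ^+ d - Qr ^+ i) * \sum_(y | dist x y == i) v y.
  rewrite !mulr_sumr [X in _ = X + _]big_mkcond [X in _ = _ + X]big_mkcond.
  rewrite -big_split /=; apply: eq_bigr => y _; rewrite mulrDr.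
  by congr (_ + _); case: (dist x y) => [|j] /=; rewrite ?expr0 ?subrr ?mul0r ?mulr0 //;
    rewrite ?eqSS; case: eqP => [<-|_]; rewrite ?mulr1 ?mulr0 //= mulrC.
rewrite IH => E; apply: (mulfI (Qr_X_neq1 i)).
have -> : (Qr ^+ i.+1 - 1) * (- (Qr ^+ d - Qr ^+ i) / (Qr ^+ i.+1 - 1)
     * sphere_coef i * v x) = - (Qr ^+ d - Qr ^+ i) * sphere_coef i * v x.
  by field; exact: Qr_X_neq1.
by apply/eqP; rewrite -subr_eq0; apply/eqP; rewrite -[RHS]E; ring.
Qed.

Let M x y : R := (- qr^-1) ^+ dist x y.

Let qr0 : qr != 0. Proof. by rewrite pnatr_eq0 -lt0n. Qed.

Lemma line_kernel_dist x : line_kernel (M x).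
Proof.
move=> L; rewrite (bigID (fun y => dist x y == ldist x L)) /=.
rewrite (eq_bigr (fun=> (- qr^-1) ^+ ldist x L)); last first.
  by move=> y /andP[_ /eqP E]; rewrite /M E.
rewrite (eq_bigr (fun=> (- qr^-1) ^+ (ldist x L).+1)
  (P := fun y => I y L && (dist x y != _))); last first.
  move=> y /andP[yL ni]; rewrite /M; case: (dist_line x yL) => E; last by rewrite E.
  by rewrite E eqxx in ni.
have := cardsID [set y | dist x y == ldist x L] [set y | I y L].
rewrite line_size.
have -> : [set y | I y L] :&: [set y | dist x y == ldist x L] =
   [set y | I y L & dist x y == ldist x L] by apply/setP=> y; rewrite !inE.
rewrite nearest add1n => -[] E.
rewrite !sumr_const -(cardsE (fun y => _ && (_ == _))) nearest.
have -> : #|(fun y => I y L && (dist x y != ldist x L))| = q.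
  by rewrite -E; apply: eq_card => y; rewrite !inE andbC.
rewrite -[X in _ + X]mulr_natr exprS -/qr; field; exact: qr0.
Qed.

Let c : R := \sum_(i < d.+1) sphere_coef i * (- qr^-1) ^+ i.

Lemma dist_eigen (v : X -> R) x : line_kernel v ->
  \sum_y M x y * v y = c * v x.
Proof.
move=> kv; rewrite /c mulr_suml.
rewrite (partition_big (fun y => inord (dist x y) : 'I_d.+1) predT) //=.
apply: eq_bigr => i _; rewrite mulrAC -(sphere_sum x i kv) mulr_suml.
apply: eq_big => [y|y].
  by rewrite -val_eqE /= inordK // ltnS dist_le.
by rewrite -val_eqE /= inordK ?ltnS ?dist_le // => /eqP E; rewrite /M E mulrC.
Qed.

(* The generating function [G] satisfies [(1 - z) G (Q z) = (1 - Q^d z) G z], so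
   its zero at 1 propagates to [Q^-1], [Q^-2], ..., [Q^-(d-1)]. *)
Lemma dist_genfun0 (v : X -> R) x j : line_kernel v -> (j < d)%N ->
  \sum_y v y * (Qr ^- j) ^+ dist x y = 0.
Proof.
move=> kv; have Q0 : Qr != 0 by rewrite pnatr_eq0 -lt0n ltnW.
pose G z := \sum_y v y * z ^+ dist x y.
have GE z : (1 - z) * G (Qr * z) = (1 - Qr ^+ d * z) * G z.
  have := near_flag_sum (fun i => z ^+ i) x kv => /(congr1 ( *%R z)).
  rewrite mulr0 => E; apply/eqP; rewrite -subr_eq0 -[X in _ == X]E /G; apply/eqP.
  rewrite !mulr_sumr -sumrB; apply: eq_bigr => y _.
  rewrite exprMn; case: (dist x y) => [|i] /=; rewrite ?expr0 ?exprS; ring.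
elim: j => [|j IH] jd.
  have := GE 1; rewrite subrr mul0r mulr1 => /esym/eqP.
  rewrite mulf_eq0 subr_eq0 => /orP[/eqP E|/eqP E].
    move: (Qr_X_neq1 d.-1); rewrite prednK //; by rewrite -E subrr eqxx.
  by rewrite expr0 invr1.
have := GE (Qr ^- j.+1).
have -> : Qr * Qr ^- j.+1 = Qr ^- j.
  by rewrite exprS; field; rewrite Q0 expf_neq0.
rewrite {1}/G IH ?(ltnW jd) // mulr0 => /esym/eqP.
rewrite mulf_eq0 => /orP[|/eqP //]; rewrite subr_eq0 => /eqP E.
have := Qr_X_neq1 (d - j.+1).-1; rewrite prednK ?subn_gt0 //.
have -> : Qr ^+ (d - j.+1) = Qr ^+ d * Qr ^- j.+1.
  by rewrite -expfB // ltnW.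
by rewrite -E subrr eqxx.
Qed.

(** By [q2E] the square of [- qr^-1] is [Q^-k], so the cube of [M x y] is [M x y] times
    [(Q^-k)^(dist x y)]: the sum is the generating function of [M x] at one of its zeros. *)
Lemma dist_cubic0 x : \sum_y M x y ^+ 3 = 0.
Proof.
rewrite -[RHS](dist_genfun0 x (line_kernel_dist x) k_lt_d).
apply: eq_bigr => y _; rewrite /M.
have -> : Qr ^- k = (- qr^-1) ^+ 2.
  by rewrite sqrrN /Qr -natrX -q2E natrX -exprVn.
by rewrite -[RHS]mulrC -!exprM -exprD; congr (_ ^+ _); lia.
Qed.

Lemma near_polygon_cubic (v : X -> R) : line_kernel v -> \sum_x v x ^+ 3 = 0.
Proof.
move=> kv; case: (pickP (@predT X)) => [x0 _|X0]; last first.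
  by apply: big1 => x _; have := X0 x.
have Msym x y : M x y = M y x by rewrite /M distC.
have Mxx x : M x x = 1 by rewrite /M (eqP (_ : dist x x == 0%N)) // dist0.
have MM x y : \sum_z M x z * M y z = c * M x y.
  by rewrite (dist_eigen _ (line_kernel_dist y)) Msym.
have c0 : c != 0.
  (* The diagonal entry of [MM] at [x0] is a sum of squares, one of them equal to 1. *)
  have : c = \sum_z M x0 z * M x0 z by rewrite MM Mxx mulr1.
  move=> ->; rewrite gt_eqF // (bigD1 x0) //= Mxx mulr1.
  apply: ltr_pwDl => //; apply: sumr_ge0 => z _; rewrite -expr2; exact: sqr_ge0.
apply: (cubic_sum_eq0 c0 MM dist_cubic0) => x; exact: dist_eigen.
Qed.

Lemma near_polygon_ovoid (m : nat) (O : {set X}) :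
    (forall L, #|O :&: [set x | I x L]| = m) -> O != set0 -> O != setT ->
  (2 * m = q + 1)%N.
Proof.
move=> Om /set0Pn[x0 x0O] OT.
pose r : R := m%:R / q.+1%:R.
pose v x : R := (x \in O)%:R - r.
have kv : line_kernel v.
  move=> L; rewrite sumrB sumr_const -natr_sum.
  have -> : (\sum_(i | I i L) (i \in O) = m)%N.
    rewrite -(Om L) -sum1_card [in RHS]big_mkcond [in LHS]big_mkcond.
    by apply: eq_bigr => x _; rewrite !inE andbC; case: (I x L); case: (x \in O).
  have -> : #|(fun i => I i L)| = q.+1.
    by rewrite -(line_size L); apply: eq_card => x; rewrite inE.
  by rewrite -[r *+ _]mulr_natr /r divfK ?subrr // pnatr_eq0.
have sumv n : \sum_x v x ^+ n = #|O|%:R * (1 - r) ^+ n + #|~: O|%:R * (- r) ^+ n.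
  rewrite (bigID (mem O)) /=; congr (_ + _).
    rewrite -sum1_card natr_sum mulr_suml; apply: eq_bigr => x xO.
    by rewrite /v xO mul1r.
  rewrite -sum1_card natr_sum mulr_suml; apply: eq_big => x; first by rewrite inE.
  by rewrite /v => /negPf ->; rewrite mul1r sub0r.
have S1 : #|O|%:R * (1 - r) = #|~: O|%:R * r.
  have := dist_genfun0 x0 kv (leq_ltn_trans (leq0n k) k_lt_d).
  rewrite expr0 invr1; under eq_bigr => y _ do rewrite expr1n mulr1 -[v y]expr1.
  by rewrite sumv !expr1 mulrN => /eqP; rewrite subr_eq0 => /eqP.
have S3 := near_polygon_cubic kv.
have a0 : #|O|%:R != 0 :> R.
  by rewrite pnatr_eq0 -lt0n; apply/card_gt0P; exists x0.
have b0 : #|~: O|%:R != 0 :> R.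
  rewrite pnatr_eq0 cards_eq0; apply: contra OT => /eqP E.
  by rewrite -[O]setCK E setC0.
have r0 : r != 0.
  by apply: contra_neq a0 => r0; move: S1; rewrite r0 subr0 mulr1 mulr0.
(* With [a = #|O|], [b = #|~: O|] and [a (1 - r) = b r], the cubic sum [a (1 - r)^3 - b r^3] equals
   [b r (1 - 2 r)]. *)
have : (#|~: O|%:R * r) * (1 - 2 * r) = 0.
  rewrite -[RHS]S3 sumv.
  transitivity ((#|~: O|%:R * r) * (1 - r) ^+ 2 + #|~: O|%:R * (- r) ^+ 3); first by ring.
  by rewrite -S1; ring.
move/eqP; rewrite mulf_eq0 (negPf (mulf_neq0 b0 r0)) /= subr_eq0 => /eqP E.
have : (2 * m)%:R = q.+1%:R :> R.
  transitivity (2 * r * q.+1%:R); last by rewrite -E mul1r.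
  by rewrite natrM -mulrA /r divfK // pnatr_eq0.
by move/eqP; rewrite eqr_nat addn1 => /eqP.
Qed.
End NearPolygon.

(** * Counting hyperplanes between two subspaces *)

Section Hyperplanes.
Variables (F : finFieldType) (n : nat).
(* Naming the canonical structure of ['rV[F]_n] explicitly keeps all occurrences
   of [\dim] and [{vspace _}] syntactically equal, as [lia] needs. *)
Local Notation V := (matrix_matrix__canonical__vector_Vector F 1 n).
Implicit Types A L U W : {vspace V}.

Lemma dim_addv_line U (v : V) : v \notin U -> \dim (U + <[v]>) = (\dim U).+1.
Proof.
move=> vU; rewrite dimv_disjoint_sum; last first.
  apply/eqP; rewrite -subv0; apply/subvP=> w /memv_capP[wU /vlineP[a E]].
  rewrite memv0 E; case: (eqVneq a 0) => [->|a0]; first by rewrite scale0r.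
  by case/negP: vU; rewrite -[v](scalerK a0) -E memvZ.
rewrite dim_vline; case: eqP vU => [->|_ _]; first by rewrite mem0v.
by rewrite addn1.
Qed.

Lemma hyperplane_span L W (v : V) : (L <= W)%VS -> \dim W = (\dim L).+1 ->
  v \in W -> v \notin L -> W = (L + <[v]>)%VS.
Proof.
move=> LW dW vW vL; apply/esym/eqP; rewrite eqEdim subv_add LW -memvE vW /=.
by rewrite dim_addv_line // dW.
Qed.

(** Taken with [W] a point [y] on the line [L] and [U = x :&: y], this leaves two possible distances
    from [x] to [y]. *)
Lemma dim_cap_hyperplane U L W : (U <= W)%VS -> (L <= W)%VS ->
  \dim W = (\dim L).+1 -> \dim U = (\dim (U :&: L) + ~~ (U <= L)%VS)%N.
Proof.
move=> UW LW dW; case: (boolP (U <= L)%VS) => UL.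
  by rewrite (capv_idPl UL) addn0.
have := dimv_sum_cap U L.
have : (\dim L < \dim (U + L))%N.
  rewrite ltnNge; apply: contra UL => h.
  have : (L == U + L)%VS by rewrite eqEdim addvSr h.
  by move=> /eqP ->; rewrite addvSl.
have : (\dim (U + L) <= \dim W)%N by rewrite dimvS // subv_add UW LW.
by rewrite dW /=; lia.
Qed.

Lemma card_vspaceD U W : (U <= W)%VS ->
  #|[set v | (v \in W) && (v \notin U)]| = (#|F| ^ \dim W - #|F| ^ \dim U)%N.
Proof.
move=> UW; rewrite -!card_vspace -(cardsE (mem W)) -(cardsE (mem U)).
rewrite -cardsDS; last by apply/subsetP=> v; rewrite !inE; apply: (subvP UW).
by apply: eq_card => v; rewrite !inE andbC.
Qed.

(** Induction on the codimension of [A], counting pairs [(L, v)] with [v] in [L] outside [A]: the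
    [L] through a given [v] are the hyperplanes over [A + <[v]>], of codimension one less. *)
Lemma card_hyperplanes A W : (A <= W)%VS ->
  ((#|F| - 1) * #|[set L : {vspace V} | [&& A <= L, L <= W
      & \dim W == (\dim L).+1]%VS]| = #|F| ^ (\dim W - \dim A) - 1)%N.
Proof.
set Q := #|F|; have Q1 : (1 < Q)%N by apply: finNzRing_gt1.
move dk: (\dim W - \dim A)%N => k; elim: k A dk => [|k IH] A dk AW.
  have AWE : A = W by apply/eqP; rewrite eqEdim AW -subn_eq0 dk.
  rewrite expn0 subnn -AWE [X in (_ * X)%N](_ : _ = 0%N) ?muln0 //.
  apply/eqP; rewrite cards_eq0 -subset0; apply/subsetP=> L.
  by rewrite !inE => /and3P[/dimvS AL _ /eqP]; lia.
have dA : \dim W = (\dim A + k.+1)%N by have := dimvS AW; lia.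
(* In codimension 1 the double count is void, since [L = A] has no vectors outside [A]. *)
case: k IH dk dA => [|k] IH dk dA.
  rewrite expn1 [X in (_ * X)%N](_ : _ = 1%N) ?muln1 //.
  apply/eqP/cards1P; exists A; apply/setP=> L; rewrite !inE.
  apply/and3P/eqP => [[AL LW /eqP dL]|->]; last by rewrite subvv AW dA addn1.
  by apply/esym/eqP; rewrite eqEdim AL; lia.
set H := [set L : {vspace V} | _].
have count : (#|H| * (Q ^ (\dim A + k.+1) - Q ^ \dim A) * (Q - 1)
    = (Q ^ (\dim A + k.+2) - Q ^ \dim A) * (Q ^ k.+1 - 1))%N.
  rewrite -sum_nat_const -dA -(card_vspaceD AW) -sum_nat_const big_distrl /=.
  transitivity (\sum_(L in H) \sum_(v in V | (v \in L) && (v \notin A)) (Q - 1))%N.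
    apply: eq_bigr => L; rewrite inE => /and3P[AL LW /eqP dL].
    have -> : (\dim A + k.+1 = \dim L)%N by lia.
    rewrite -(card_vspaceD AL) -sum_nat_const; apply: eq_bigl => v; by rewrite !inE.
  rewrite (exchange_big_dep (fun v => (v \in W) && (v \notin A))) /=; last first.
    move=> L v; rewrite inE => /and3P[_ LW _] /andP[vL ->].
    by rewrite (subvP LW).
  apply: eq_big => [v|v /andP[vW vA]]; first by rewrite inE.
  have AvW : (A + <[v]> <= W)%VS by rewrite subv_add AW -memvE.
  have dAv := dim_addv_line vA.
  have := IH (A + <[v]>)%VS; rewrite AvW dAv => <- //; last by lia.
  rewrite sum_nat_const mulnC; congr (_ * _)%N; apply: eq_card => L.
  rewrite [LHS]unfold_in /= [L \in H]inE [RHS]inE vA subv_add -memvE andbT.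
  by case: (A <= L)%VS; case: (v \in L); case: (L <= W)%VS; rewrite /= ?andbT ?andbF.
have QD j : (Q ^ (\dim A + j) - Q ^ \dim A = Q ^ \dim A * (Q ^ j - 1))%N.
  by rewrite expnD mulnBr muln1.
have Q0 : (0 < Q ^ \dim A * (Q ^ k.+1 - 1))%N.
  by rewrite muln_gt0 expn_gt0 ltnW //= subn_gt0 -(expn0 Q) ltn_exp2l.
apply/eqP; rewrite -(eqn_pmul2r Q0); apply/eqP.
rewrite !QD in count; rewrite [RHS]mulnCA [RHS]mulnA -count.
by rewrite [RHS]mulnC [RHS]mulnA.
Qed.
End Hyperplanes.

(** * Orthogonal complements for a possibly degenerate form *)

Section Pairing.
Variables (F : fieldType) (eps : bool) (theta : {rmorphism F -> F}).
Variables (V : vectType F) (B : {hermitian V for eps & theta}).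
Implicit Types A C : {vspace V}.
Local Open Scope vspace_scope.

Lemma orthovS A C : A <= C -> orthov B C <= orthov B A.
Proof. by move=> sAC; rewrite orthov_sym (subv_trans sAC) // orthov_sym. Qed.

Lemma dim_cap_orthov_geq A C : (\dim A <= \dim (A :&: orthov B C) + \dim C)%N.
Proof.
suff span_case (s : seq V) : (\dim A <= \dim (A :&: orthov B <<s>>) + size s)%N.
  by have := span_case (vbasis C); rewrite (span_basis (vbasisP C)) size_tuple.
elim: s A {C} => [|c s IH] A; first by rewrite span_nil orthov0 capvf addn0.
have <- : (A :&: orthov B <[c]>) :&: orthov B <<s>> = A :&: orthov B <<c :: s>>.
  rewrite -capvA; congr (_ :&: _); apply/eqP; rewrite span_cons eqEsubv.
  by rewrite orthovD capvSl capvSr subv_cap !orthovS ?addvSl ?addvSr.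
have := IH (A :&: orthov B <[c]>); have := leq_dim_orthov1 B c A.
by rewrite /=; lia.
Qed.

(** Row rank equals column rank for the form restricted to [A] and [C]. [B] may be degenerate, as
    the polar form of DQ is in characteristic 2. *)
Lemma dim_cap_orthov A C :
  (\dim A + \dim (C :&: orthov B A) = \dim C + \dim (A :&: orthov B C))%N.
Proof.
have half U W : (\dim U + \dim (W :&: orthov B U) <= \dim W + \dim (U :&: orthov B W))%N.
  set K := W :&: orthov B U; have := dim_cap_orthov_geq U (W :\: K).
  have -> : U :&: orthov B (W :\: K) = U :&: orthov B W.
    apply/eqP; rewrite eqEsubv !subv_cap !capvSl /= andbC.
    rewrite (subv_trans (capvSr _ _)) ?orthovS ?diffvSl //=.
    rewrite -{2}(addv_diff_cap W K) orthovD capvSr /=.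
    by rewrite (subv_trans (capvSl _ _)) // orthov_sym !(subv_trans (capvSr _ _)).
  by have := dimv_cap_compl W K; rewrite (capv_idPr (capvSl _ _)) -/K; lia.
by apply/eqP; rewrite eqn_leq !half.
Qed.
End Pairing.

(** * Dual polar spaces as near polygons *)

Lemma point_count_arith Q D d k q h : (1 < Q)%N -> (0 < d)%N -> (1 < D)%N ->
    (k * Q ^ D.-2 = q * Q ^ d.-1 -> h * (Q ^ d - Q ^ d.-1) * Q
      = (Q ^ D - Q ^ D.-1) * k -> h = q)%N.
Proof.
case: d D => // d [|[|D]] // Q1 _ _ kE.
have Q0 : (0 < Q ^ d * (Q - 1) * Q)%N.
  by rewrite !muln_gt0 expn_gt0 subn_gt0 Q1 ltnW.
have QD j : (Q ^ j.+1 - Q ^ j = Q ^ j * (Q - 1))%N by rewrite expnSr mulnBr muln1.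
rewrite !QD /= => count; apply/eqP; rewrite -(eqn_pmul2r Q0); apply/eqP.
transitivity (q * Q ^ d * ((Q - 1) * Q))%N; last by rewrite !mulnA.
by move: kE => /= <-; rewrite mulnA count expnSr; lia.
Qed.

Lemma card_sig_set (T : finType) (P A : pred T) :
  #|[set x : {y | P y} | A (val x)]| = #|[set y | P y && A y]|.
Proof.
rewrite -(card_imset _ val_inj); apply: eq_card => y; rewrite inE.
apply/imsetP/andP => [[x + ->]|[Py Ay]]; first by rewrite inE (valP x).
by exists (exist _ y Py); rewrite ?inE.
Qed.

(* The three families of forms are treated at once: [iso] is the set of isotropic (or
   singular) vectors, [D] the dimension of [perp L] for a line [L], and [kappa]
   the number of isotropic vectors in a coset [v + <[e]>] with [e] isotropic and
   not orthogonal to [v].  For DQ, [(D, kappa) = (d + 2, 1)]; for DW and DH,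
   [(D, kappa) = (d + 1, q)]. *)
Section PolarSpace.
Variables (F : finFieldType) (eps : bool) (theta : {rmorphism F -> F}) (n : nat).
Local Notation V := (matrix_matrix__canonical__vector_Vector F 1 n).
Variable B : {hermitian V for eps & theta}.
Variables (iso : pred V) (T : pred {vspace V}) (d D kappa q : nat).
Local Notation perp := (orthov B).
Implicit Types (u v w : V) (U L W : {vspace V}).

Hypothesis TP : forall U,
  reflect ((forall u, u \in U -> iso u) /\ (U <= perp U)%VS) (T U).
Hypothesis isoD : forall u v, iso u -> iso v -> B u v = 0 -> iso (u + v).
Hypothesis isoZ : forall a v, iso v -> iso (a *: v).
Hypothesis iso_self : forall v, iso v -> B v v = 0.
Hypothesis iso_rad : forall v, iso v -> (forall u, B v u = 0) -> v = 0.
Hypothesis d_gt0 : (0 < d)%N.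
Hypothesis nE : n = (D + d.-1)%N.
Hypothesis n_lt : (n < d.*2.+2)%N.
Hypothesis D_gt : (d < D)%N.
Hypothesis iso_pencil : forall e v, iso e -> B v e != 0 ->
  #|[set a | iso (v + a *: e)]| = kappa.
Hypothesis kappaE : (kappa * #|F| ^ D.-2 = q * #|F| ^ d.-1)%N.

Lemma isotropicS U W : (U <= W)%VS -> T W -> T U.
Proof.
move=> UW /TP[iW oW]; apply/TP; split=> [u /(subvP UW)|]; first exact: iW.
by rewrite (subv_trans UW) // (subv_trans oW) // orthovS.
Qed.

Lemma isotropicD U W : T U -> T W -> (U <= perp W)%VS -> T (U + W)%VS.
Proof.
move=> /TP[iU oU] /TP[iW oW] UW; apply/TP; split.
  move=> _ /memv_addP[u uU [w wW ->]]; apply: isoD; [exact: iU|exact: iW|].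
  by move/orthovP: UW => ->.
by rewrite orthovD !orthoDv oU oW UW orthov_sym UW.
Qed.

Lemma isotropic_line v : iso v -> T <[v]>%VS.
Proof.
move=> iv; apply/TP; split; last by rewrite orthov11 iso_self.
by move=> u /vlineP[a ->]; apply: isoZ.
Qed.

Lemma isotropic_addv_line U v : T U -> iso v -> v \in perp U -> T (U + <[v]>)%VS.
Proof.
move=> TU iv vU; apply: isotropicD => //; first exact: isotropic_line.
by rewrite orthov_sym -memvE.
Qed.

(** The form may have a radical, but by [iso_rad] the radical meets [U] only in 0, so the pairing of
    [U] with the whole space has rank [\dim U]. *)
Lemma dim_perp U : T U -> (\dim U + \dim (perp U) = n)%N.
Proof.
move=> TU; have := dim_cap_orthov B fullv U; rewrite capfv.
have -> : (U :&: perp fullv = 0)%VS.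
  apply/eqP; rewrite -subv0; apply/subvP=> v /memv_capP[vU /mem_orthovP vr].
  rewrite memv0; apply/eqP/iso_rad; first by have [iU _] := elimT (TP _) TU; apply: iU.
  by move=> u; apply: vr; rewrite memvf.
by rewrite dimv0 addn0 dimvf /dim /= mul1n => <-.
Qed.

Lemma dim_perpE U : T U -> \dim (perp U) = (n - \dim U)%N.
Proof. by move=> /dim_perp h; apply: (@addnI (\dim U)); clear -h; lia. Qed.

Lemma isotropic_dim U : T U -> (\dim U <= d)%N.
Proof.
move=> TU; have := dim_perp TU; have [_ /dimvS] := elimT (TP _) TU; lia.
Qed.

Lemma pointE U : maximal_isotropic T U && (\dim U == d) = T U && (\dim U == d).
Proof.
rewrite /maximal_isotropic -andbA; case: (boolP (T U)) => //= TU.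
case: eqP => [dU|]; rewrite ?andbF ?andbT //.
apply/forallP=> W; apply/implyP=> /andP[TW UW].
by rewrite eq_sym eqEdim UW dU isotropic_dim.
Qed.

Lemma maximal_mem U v : T U -> \dim U = d -> iso v -> v \in perp U -> v \in U.
Proof.
move=> TU dU iv vU; apply: contraT => vnU.
have := isotropic_dim (isotropic_addv_line TU iv vU).
by rewrite dim_addv_line // dU ltnn.
Qed.

(** By maximality [U :&: L] is the part of [L] orthogonal to [U]; the rank identity [dim_cap_orthov]
    then carries over the gap [\dim U - \dim L = 1]. *)
Lemma dim_cap_perp U L : T U -> \dim U = d -> T L -> \dim L = d.-1 ->
  \dim (U :&: perp L) = (\dim (U :&: L)).+1.
Proof.
move=> TU dU TL dL; have := dim_cap_orthov B U L; rewrite dU dL.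
have -> : (L :&: perp U = U :&: L)%VS; last by lia.
apply/eqP; rewrite eqEsubv !subv_cap capvSl capvSr /= andbT; apply/andP; split.
  apply/subvP=> v /memv_capP[vL vU]; apply: maximal_mem => //.
  by have [iL _] := elimT (TP _) TL; apply: iL.
by have [_ oU] := elimT (TP _) TU; rewrite (subv_trans (capvSl _ _)).
Qed.

(** The near polygon axiom. A point [W] on [L] that meets [U] in some [w] outside [L] is [L + <[w]>]
    with [w] in [perp L], hence lies in [L + (U :&: perp L)], which has the same dimension. *)
Lemma nearest_point U L W : T U -> \dim U = d -> T L -> \dim L = d.-1 ->
  (T W && (\dim W == d) && (L <= W)%VS && (\dim (U :&: W) != \dim (U :&: L)))
  = (W == L + (U :&: perp L))%VS.
Proof.
move=> TU dU TL dL; have dUL := dim_cap_perp TU dU TL dL.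
have [_ oL] := elimT (TP _) TL.
set P := (L + (U :&: perp L))%VS.
have UPL : (U :&: perp L :&: L = U :&: L)%VS.
  by rewrite -capvA (capv_idPr oL).
have dP : \dim P = d.
  by have := dimv_sum_cap (U :&: perp L) L; rewrite UPL addvC -/P dUL dL; lia.
have TP0 : T P.
  apply: isotropicD => //; first exact: isotropicS (capvSl _ _) TU.
  by rewrite orthov_sym capvSr.
have dUP : (\dim (U :&: L) < \dim (U :&: P))%N.
  by rewrite -dUL dimvS // subv_cap capvSl addvSr.
apply/idP/eqP => [/andP[/andP[/andP[TW /eqP dW] LW] dUW]|->]; last first.
  by rewrite TP0 dP eqxx addvSl /=; move: dUP; rewrite ltn_neqAle eq_sym => /andP[].
have [w wUW wL] : exists2 w, w \in (U :&: W)%VS & w \notin L.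
  apply/subvPn; apply: contra dUW => h; apply/eqP; congr (\dim _); apply/eqP.
  by rewrite eqEsubv !subv_cap !capvSl h (subv_trans (capvSr _ _)).
have [wU wW] := memv_capP wUW.
have -> : W = (L + <[w]>)%VS by apply: hyperplane_span; rewrite ?dW ?dL ?prednK.
apply/eqP; rewrite eqEdim dim_addv_line // dP dL; rewrite prednK // leqnn andbT.
rewrite addvS // -memvE memv_cap wU /=.
have [_ /subvP oW] := elimT (TP _) TW.
by apply/(subvP (orthovS B LW))/oW.
Qed.

(* Fix [W0] on [L] and [e] in [W0] outside [L].  The isotropic vectors of
   [perp L] not orthogonal to [e] are counted along the cosets of [<[e]>] and
   as the disjoint union of the sets [W \ L] for the other points [W] on [L]. *)
Lemma card_points_on L W0 : T L -> \dim L = d.-1 ->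
    T W0 -> \dim W0 = d -> (L <= W0)%VS ->
  #|[set W | T W && (\dim W == d) && (L <= W)%VS]| = q.+1.
Proof.
move=> TL dL TW0 dW0 LW0; set Q := #|F|.
have Q1 : (1 < Q)%N by apply: finNzRing_gt1.
have [iL oL] := elimT (TP _) TL; have [iW0 oW0] := elimT (TP _) TW0.
have [e eW0 eL] : exists2 e, e \in W0 & e \notin L.
  by apply/subvPn; apply/negP=> /dimvS; lia.
have W0E : W0 = (L + <[e]>)%VS by apply: hyperplane_span; rewrite ?dW0 ?dL ?prednK.
have ie := iW0 e eW0.
pose E := [set v | (v \in perp L) && (v \notin perp W0)].
have cE : #|E| = (Q ^ D - Q ^ D.-1)%N.
  have -> : D = \dim (perp L) by rewrite dim_perpE // dL; clear -nE; lia.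
  have -> : (\dim (perp L)).-1 = \dim (perp W0).
    by rewrite !dim_perpE // dL dW0; clear -d_gt0; lia.
  exact: card_vspaceD (orthovS B LW0).
have perpW0 v : v \in perp L -> (v \in perp W0) = (B v e == 0).
  by move=> vL; rewrite W0E -mem_orthov1 [LHS]memvE orthovD -!memvE vL.
set H := [set W | _].
have W0H : W0 \in H by rewrite inE TW0 dW0 eqxx.
rewrite (cardsD1 W0) W0H add1n; congr _.+1; set H' := H :\ W0.
pose N := [set v in E | iso v].
have eP : e \in perp L by apply/(subvP (orthovS B LW0))/(subvP oW0).
have shift v a : v \in E -> v + a *: e \in E.
  rewrite !inE => /andP[vL vW0]; rewrite rpredD ?rpredZ //=.
  move: vW0; rewrite !perpW0 ?rpredD ?rpredZ // linearDl linearZl_LR /=.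
  by rewrite iso_self // mulr0 addr0.
have count1 : (#|N| * Q = #|E| * kappa)%N.
  transitivity (\sum_(a : F) \sum_(v in E | iso (v + a *: e)%R) 1)%N.
    rewrite -/Q mulnC -sum_nat_const; apply: eq_bigr => a _.
    rewrite -sum1_card (reindex_inj (addIr (a *: e))) /=.
    apply: eq_bigl => v; rewrite inE; congr (_ && _).
    by apply/idP/idP => [/(shift _ (- a))|/shift //]; rewrite scaleNr addrK.
  rewrite (exchange_big_dep (mem E)) /=; last by move=> a v _ /andP[].
  rewrite -sum_nat_const; apply: eq_bigr => v vE.
  rewrite -(@iso_pencil e v) //; last first.
    by move: vE; rewrite inE => /andP[vL]; rewrite perpW0.
  by rewrite -sum1_card; apply: eq_bigl => a; rewrite inE vE.
have count2 : (#|N| = #|H'| * (Q ^ d - Q ^ d.-1))%N.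
  transitivity (\sum_(W in H') \sum_(v | (v \in W) && (v \notin L)) 1)%N; last first.
    rewrite -sum_nat_const; apply: eq_bigr => W.
    rewrite in_setD1 inE => /andP[_ /andP[/andP[_ /eqP dW] LW]].
    transitivity (Q ^ \dim W - Q ^ \dim L)%N; last by rewrite dW dL.
    rewrite -(card_vspaceD LW) -sum1_card; apply: eq_bigl => v.
    by rewrite inE.
  rewrite (exchange_big_dep (mem N)) /=; last first.
    move=> W v; rewrite in_setD1 inE => /andP[WW0 /andP[/andP[TW /eqP dW] LW]] /andP[vW vL].
    have [iW oW] := elimT (TP _) TW; rewrite !inE iW // andbT.
    rewrite (subvP (orthovS B LW)) ?(subvP oW) //=.
    apply: contra WW0 => vW0; have vinW0 := maximal_mem TW0 dW0 (iW v vW) vW0.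
    rewrite [W](hyperplane_span LW _ vW vL) ?dW ?dL ?prednK //.
    by rewrite [W0](hyperplane_span LW0 _ vinW0 vL) ?dW0 ?dL ?prednK //.
  rewrite -sum1_card; apply: eq_bigr => v.
  rewrite !inE => /andP[/andP[vL vW0] iv].
  have vnL : v \notin L.
    by apply: contra vW0 => vL'; apply/(subvP oW0)/(subvP LW0).
  rewrite (big_pred1 (L + <[v]>)%VS) // => W; rewrite in_setD1 inE vnL andbT /=.
  apply/idP/eqP => [/andP[/andP[_ /andP[/andP[_ /eqP dW] LW]] vW]|->].
    by apply: hyperplane_span; rewrite ?dW ?dL ?prednK.
  rewrite isotropic_addv_line // dim_addv_line // dL prednK // eqxx addvSl /=.
  have vLv : v \in (L + <[v]>)%VS by rewrite memvE addvSr.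
  rewrite vLv !andbT; apply: contra vW0 => /eqP h.
  by apply: (subvP oW0); rewrite -h.
move: count1; rewrite count2 cE.
move=> count; apply: (point_count_arith Q1 d_gt0 _ kappaE count).
exact: leq_ltn_trans d_gt0 D_gt.
Qed.
Variable k : nat.
Hypothesis q_gt0 : (0 < q)%N.
Hypothesis k_lt_d : (k < d)%N.
Hypothesis q2E : (q ^ 2 = #|F| ^ k)%N.

Let S := dual_polar_space T d.

Let pointP (x : point S) : T (val x) /\ \dim (val x) = d.
Proof.
by have /andP[/andP[Tx _] /eqP] := valP x.
Qed.

Let lineP (L : line S) : T (val L) /\ \dim (val L) = d.-1.
Proof. by have /andP[? /eqP] := valP L. Qed.

Let card_points (P : pred {vspace V}) :
  #|[set x : point S | P (val x)]| = #|[set W | T W && (\dim W == d) && P W]|.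
Proof.
rewrite [LHS]card_sig_set; apply: eq_card => W; rewrite !inE.
by rewrite pointE.
Qed.

Let card_lines (y : point S) (A : {vspace V}) : (A <= val y)%VS ->
  ((#|F| - 1) * #|[set L : line S | incident y L & (A <= val L)%VS]|
   = #|F| ^ (d - \dim A) - 1)%N.
Proof.
have [Ty dy] := pointP y; move=> Ay.
transitivity (#|F| ^ (\dim (val y) - \dim A) - 1)%N; last by rewrite dy.
rewrite -(card_hyperplanes Ay).
congr (_ * _)%N.
rewrite (card_sig_set (fun L => T L && (\dim L == d.-1))
          (fun L => (L <= val y)%VS && (A <= L)%VS)).
apply: eq_card => L; rewrite !inE dy andbC.
case: (A <= L)%VS; rewrite ?andbF //= andbT; case: (boolP (L <= val y)%VS) => //= Ly.
rewrite (isotropicS Ly Ty) /=.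
by rewrite -[in RHS](prednK d_gt0) eqSS eq_sym.
Qed.

(** The projection of [x0] onto [L] provides the first point [W0] that [card_points_on] starts
    from. *)
Let points_on_size (x0 : point S) (L : line S) : #|points_on L| = q.+1.
Proof.
have [[TL dL] [Tx dx]] := (lineP L, pointP x0).
have := nearest_point (val L + (val x0 :&: perp (val L)))%VS Tx dx TL dL.
rewrite eqxx => /andP[/andP[/andP[TW /eqP dW] LW] _].
rewrite -(card_points_on TL dL TW dW LW).
exact: (card_points (fun W => (val L <= W)%VS)).
Qed.

Lemma polar_space_ovoid (m : nat) (O : {set point S}) :
  is_ovoid m O -> nontrivial O -> hemisystem O /\ (2 * m = q + 1)%N.
Proof.
move=> Om [/eqP O0 /eqP OT].
have [x0 _] := set0Pn _ O0.
have Q1 : (1 < #|F|)%N := finNzRing_gt1 F.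
suff E : (2 * m = q + 1)%N.
  split=> //; exists m => // L.
  by rewrite points_on_size // E addn1.
pose dist (x y : point S) := (d - \dim (val x :&: val y)%VS)%N.
pose ldist (x : point S) (L : line S) := (d.-1 - \dim (val x :&: val L)%VS)%N.
have dimx (x : point S) : \dim (val x) = d by have [] := pointP x.
have dimL (L : line S) : \dim (val L) = d.-1 by have [] := lineP L.
(* These bounds make the truncated subtractions in [dist] and [ldist] exact. *)
have dimI (x y : point S) : (\dim (val x :&: val y) <= d)%N.
  by apply: (leq_trans (dimvS (capvSl _ _))); rewrite dimx.
have dimIL (x : point S) (L : line S) : (\dim (val x :&: val L) <= d.-1)%N.
  by apply: (leq_trans (dimvS (capvSr _ _))); rewrite dimL.
(* A point [y] of [L] is nearest to [x] unless [x :&: y] lies in [L]. *)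
have capL (x y : point S) (L : line S) : incident y L ->
  \dim (val x :&: val y) = (\dim (val x :&: val L) + ~~ (val x :&: val y <= val L)%VS)%N.
  move=> yL; rewrite (@dim_cap_hyperplane _ _ _ (val L) (val y)) ?capvSr //; last first.
    by rewrite dimx dimL prednK.
  by rewrite -capvA (capv_idPr yL).
apply: (@near_polygon_ovoid rat _ _ (@incident S) dist ldist d q #|F| k
  _ _ _ _ _ _ _ _ _ _ _ _ m O) => //.
- move=> x y; rewrite subn_eq0; apply/idP/eqP => [h|->]; last by rewrite capvv dimx.
  apply: val_inj; apply/eqP; rewrite eqEdim !dimx leqnn andbT.
  have : (val x :&: val y == val x)%VS by rewrite eqEdim capvSl dimx.
  by move/eqP/capv_idPl.
- by move=> x y; rewrite /dist capvC.
- by move=> x y; rewrite leq_subr.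
- by move=> L; exact: points_on_size.
- move=> x y L yL; rewrite /dist /ldist (capL x y L yL).
  have := dimI x y; have := dimIL x L; rewrite (capL x y L yL).
  by case: (_ <= _)%VS => /=; clear -d_gt0; lia.
- move=> x L; have [[TL dL] [Tx dx]] := (lineP L, pointP x).
  transitivity #|[set (val L + (val x :&: perp (val L)))%VS]|; last by rewrite cards1.
  rewrite [LHS](_ : _ = #|[set y : point S | (val L <= val y)%VS &&
    (\dim (val x :&: val y) != \dim (val x :&: val L))]|); last first.
    apply: eq_card => y; rewrite !inE; case: (boolP (incident y L)) => [yL|/negPf];
      last by move=> /= ->.
    rewrite (yL : (val L <= val y)%VS) /dist /ldist /=.
    have := dimI x y; have := dimIL x L; rewrite (capL x y L yL).
    by case: (_ <= _)%VS => /=; clear -d_gt0; lia.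
  rewrite (card_points (fun W => (val L <= W)%VS && (\dim (val x :&: W) != _))).
  apply: eq_card => W; rewrite !inE andbA.
  exact: nearest_point.
- move=> y; have := card_lines (sub0v (val y)); rewrite dimv0 subn0 => <-.
  by congr (_ * _)%N; apply: eq_card => L; rewrite !inE sub0v andbT.
(* The lines on [y] towards [x] are those containing [x :&: y], which has codimension [dist x y] in
   [y]. *)
- move=> x y; rewrite -(card_lines (capvSr (val x) (val y))); congr (_ * _)%N.
  apply: eq_card => L; rewrite !inE; case: (boolP (incident y L)) => //= yL.
  rewrite /dist /ldist.
  have := dimI x y; have := dimIL x L; rewrite (capL x y L yL).
  by case: (_ <= _)%VS => /=; clear -d_gt0; lia.
Qed.
End PolarSpace.

(** * Verification for the three families *)

Lemma prime_power_gt1 q : prime_power q -> (1 < q)%N.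
Proof.
by case=> p [k [p_pr k_gt0 ->]]; rewrite -(expn0 p) ltn_exp2l // prime_gt1.
Qed.

Lemma card_roots_lt (F : finFieldType) (p : {poly F}) :
  p != 0 -> (#|[set x | root p x]| < size p)%N.
Proof.
move=> p0; rewrite cardE; apply: max_poly_roots; rewrite ?enum_uniq //.
by apply/allP=> x; rewrite mem_enum inE.
Qed.

(* Both the fixed field of [x |-> x ^+ q] and every fibre of the trace have at
   most [q] elements, and the [q] * [q] elements of [F] force equality. *)
Lemma card_trace_fibre (F : finFieldType) (q : nat) (b : F) : (1 < q)%N ->
    #|F| = (q ^ 2)%N -> (forall x y : F, (x + y) ^+ q = x ^+ q + y ^+ q) ->
    b ^+ q = b ->
  #|[set x : F | x + x ^+ q == b]| = q.
Proof.
move=> q1 cF qD bq.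
(* [c = 1] bounds the fibres of the trace, [c = -1] with [e = 0] the fixed field. *)
have fixle (c e : F) : (#|[set x : F | c * x + x ^+ q == e]%R| <= q)%N.
  have sizep : size ('X^q + (c *: 'X - e%:P)) = q.+1.
    rewrite size_polyDl size_polyXn // ltnS.
    rewrite (leq_trans (size_polyD _ _)) // geq_max size_polyN.
    rewrite (leq_trans (size_polyC_leq1 _)) ?(ltnW q1) // andbT.
    by rewrite (leq_trans (size_scale_leq _ _)) // size_polyX.
  have p0 : 'X^q + (c *: 'X - e%:P) != 0 by rewrite -size_poly_eq0 sizep.
  have := card_roots_lt p0; rewrite sizep ltnS; apply: leq_trans.
  apply/subset_leq_card/subsetP=> x; rewrite !inE => /eqP <-.
  rewrite /root !(hornerD, hornerN, hornerZ, hornerX, hornerC, hornerXn).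
  by apply/eqP; ring.
pose K := [set y : F | -1 * y + y ^+ q == 0].
pose N (y : F) := #|[set x : F | x + x ^+ q == y]|.
have Nle y : (N y <= q)%N.
  by have := fixle 1 y; congr (_ <= _)%N; apply: eq_card => x; rewrite !inE mul1r.
have bK : b \in K by rewrite inE bq mulN1r addNr.
have xqq (x : F) : x ^+ q ^+ q = x.
  by rewrite -exprM -[(q * q)%N]/(q ^ 2)%N -cF expf_card.
have sumN : (\sum_(y in K) N y = q ^ 2)%N.
  rewrite -cF -[RHS]sum1_card [RHS](partition_big (fun x : F => x + x ^+ q)%R (mem K)) /=.
    by apply: eq_bigr => y _; rewrite /N -sum1_card; apply: eq_bigl => x; rewrite inE.
  by move=> x _; rewrite inE qD xqq mulN1r [_ + x]addrC addNr.
apply/eqP; rewrite eqn_leq Nle /= leqNgt; apply/negP=> Nlt.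
have : (\sum_(y in K) N y < \sum_(y in K) q)%N.
  rewrite (bigD1 b bK) [X in (_ < X)%N](bigD1 b bK) /= -addSn.
  by apply: leq_add => //; apply: leq_sum => y _; apply: Nle.
rewrite sumN sum_nat_const ltnNge leq_mul2r; apply/negP; rewrite negbK.
by rewrite orbC fixle.
Qed.

Section Hermitian.
Variables (F : finFieldType) (eps : bool) (theta : {rmorphism F -> F}) (d q : nat).
Local Notation V := (matrix_matrix__canonical__vector_Vector F 1 (2 * d)).
Variable B : {hermitian V for eps & theta}.

(** Shared by DW and DH, with [D = d.+1] and [kappa = q]; the two differ in [k] and in why a coset
    of [<[e]>] has [q] isotropic vectors. *)
Lemma hermitian_ovoid k m (O : {set point (dual_polar_space (totally_isotropic B) d)}) :
    nondegenerate B ->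
    (forall e v, B e e = 0 -> B v e != 0 ->
      #|[set a | B (v + a *: e) (v + a *: e) == 0]| = q) ->
    (0 < q)%N -> (k < d)%N -> (q ^ 2 = #|F| ^ k)%N ->
    is_ovoid m O -> nontrivial O ->
  hemisystem O /\ (2 * m = q + 1)%N.
Proof.
move=> /eqP radB pencil q0 kd q2.
have d0 : (0 < d)%N by apply: leq_ltn_trans kd.
apply: (@polar_space_ovoid F eps theta _ B (fun v => B v v == 0) _ d d.+1 q q
  _ _ _ _ _ _ _ _ _ _ _ k) => //.
- move=> U; apply: (iffP idP) => [oU|[]//]; split=> // u uU.
  by apply/eqP/(orthovP oU).
- move=> u v /eqP uu /eqP vv uv.
  have /eqP vu : B v u == 0 by rewrite herm_eq0C uv.
  by rewrite linearDl !linearDr /= uu vv uv vu !addr0.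
- by move=> a v /eqP vv; rewrite linearZl_LR linearZr_LR /= vv !mulr0.
- by move=> v /eqP.
- move=> v _ vr; apply/eqP; rewrite -memv0 -radB; apply/mem_orthovP => u _.
  exact: vr.
- by case: (d) d0 => // d' _; lia.
- by lia.
- by move=> e v /eqP ee; apply: pencil.
Qed.
End Hermitian.

Section QuadraticForm.
Variables (F : finFieldType) (n : nat).
Local Notation V := (matrix_matrix__canonical__vector_Vector F 1 n).
Variable Q : V -> F.
Hypothesis qQ : quadratic_form Q.

(* A copy of [polar Q] that can carry the sesquilinear form structures. *)
Definition polar_form (u v : V) : F := polar Q u v.

Let polar_linearl v : GRing.linear_for *%R (polar_form^~ v).
Proof. exact: (qQ.2.1 v). Qed.

Let polar_linearr u : GRing.linear_for *%R (polar_form u).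
Proof. exact: (qQ.2.2 u). Qed.

HB.instance Definition _ := @isBilinear.Build F V V F *%R (idfun \; *%R) polar_form
  (fun v => zmod_morphism_linear (polar_linearl v))
  (fun u => zmod_morphism_linear (polar_linearr u))
  (fun v => scalable_linear (polar_linearl v))
  (fun u => scalable_linear (polar_linearr u)).

Let polar_formC u v : polar_form u v = (-1) ^+ false * idfun (polar_form v u).
Proof. by rewrite expr0 mul1r /= /polar_form /polar [v + u]addrC addrAC. Qed.

HB.instance Definition _ :=
  @isHermitianSesquilinear.Build F V false idfun polar_form polar_formC.

Definition polar_hermitian : {hermitian V for false & idfun} := polar_form.

Lemma quadratic_formD u v : Q (u + v) = Q u + Q v + polar_hermitian u v.
Proof. by rewrite /= /polar_form /polar; ring. Qed.

End QuadraticForm.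

(** Here [D = d.+2], [kappa = 1] and [k = 2], so that [k < d] is the bound [3 <= d]. *)
Lemma quadratic_ovoid (F : finFieldType) (d q m : nat)
    (Q : 'rV[F]_(2 * d + 1) -> F)
    (O : {set point (dual_polar_space (totally_singular Q) d)}) :
    (3 <= d)%N -> #|F| = q -> quadratic_form Q -> nonsingular Q ->
    is_ovoid m O -> nontrivial O ->
  hemisystem O /\ (2 * m = q + 1)%N.
Proof.
move=> d3 cF qQ nsQ; pose B := polar_hermitian qQ.
have QD := quadratic_formD qQ; have QZ := qQ.1.
have q1 : (1 < q)%N by rewrite -cF finNzRing_gt1.
have d0 : (0 < d)%N by apply: ltn_trans d3.
apply: (@polar_space_ovoid F false idfun _ B (fun v => Q v == 0) _ d d.+2 1 q
  _ _ _ _ _ _ _ _ _ _ _ 2) => //.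
- move=> U; apply: (iffP forall_inP) => [QU|[QU _]]; last exact: QU.
  split=> //; apply/orthovP => u v uU vU.
  have /eqP := QU _ (memvD uU vU).
  by rewrite QD (eqP (QU u uU)) (eqP (QU v vU)) !add0r.
- by move=> u v /eqP uu /eqP vv uv; rewrite QD uu vv uv !addr0.
- by move=> a v /eqP vv; rewrite QZ vv mulr0.
- move=> v /eqP vv; have := QD v v; rewrite vv !add0r => <-.
  by rewrite -mulr2n -scaler_nat QZ vv mulr0.
- by move=> v /eqP vv vr; apply: nsQ.
- by case: (d) d0 => // d' _; lia.
- by lia.
(* On the coset, [Q (v + a *: e) = Q v + a * B v e] is affine in [a] with nonzero slope. *)
- move=> e v /eqP ee ve; apply/eqP/cards1P; exists (- Q v / B v e).
  apply/setP=> a; rewrite !inE QD QZ ee mulr0 addr0 linearZr_LR /= -/(B v e).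
  rewrite addrC addr_eq0 -(can2_eq (mulfK ve) (divfK ve)).
  by [].
- rewrite mul1n cF -expnS; congr (_ ^ _)%N; lia.
- by rewrite ltnW.
- by rewrite cF.
Qed.

Local Close Scope ring_scope.

Theorem theorem1p1 (d q : nat) (hd : 3 <= d) (hq : prime_power q)
    (S : geometry) (hS : DQ_DW_DH d q S)
    (m : nat) (O : {set point S}) (hO : is_ovoid m O) (hnt : nontrivial O) :
  hemisystem O /\ (2 * m)%N = (q + 1)%N.
Proof.
have q1 := prime_power_gt1 hq.
case: hS O hO hnt => [F Q cF qQ nsQ|F B cF ndB altB|F theta B cF thetaE ndB] O hO hnt.
- exact: (quadratic_ovoid hd cF qQ nsQ hO hnt).
- apply: (@hermitian_ovoid F true idfun d q B 2 m O ndB _ _ hd _ hO hnt) => //.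
  (* For an alternating form every vector is isotropic, so all [q] scalars count. *)
  + move=> e v _ _; rewrite -cF -cardsT; apply: eq_card => a.
    by rewrite !inE altB eqxx.
  + exact: ltnW.
  + by rewrite cF.
- have qD (x y : F) : ((x + y) ^+ q = x ^+ q + y ^+ q)%R.
    by rewrite -!thetaE rmorphD.
  have d1 : (1 < d)%N by apply: ltn_trans hd.
  apply: (@hermitian_ovoid F false theta d q B 1 m O ndB _ _ d1 _ hO hnt) => //.
  + move=> e v ee ve.
    (* With [x = a * B e v], the form takes the value [B v v + x + x ^+ q] at [v + a *: e], so its
       zeros correspond to the trace fibre over [- B v v]. *)
    have hermB u w : B u w = theta (B w u) by rewrite hermC expr0 mul1r.
    rewrite -[RHS](@card_trace_fibre F q (- B v v)%R q1 cF qD); last first.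
      by rewrite -thetaE rmorphN -hermB.
    have ev : B e v != 0%R by rewrite herm_eq0C.
    rewrite -[RHS](on_card_preimset (f := fun a => a * B e v)%R); last first.
      by apply: onW_bij; exists (fun c => c / B e v)%R => a; rewrite ?mulfK ?divfK.
    apply: eq_card => a; rewrite !inE -thetaE.
    rewrite linearDl !linearDr !linearZl_LR !linearZr_LR /= ee !mulr0 addr0.
    rewrite rmorphM -hermB -[RHS]subr_eq0 opprK.
    by congr (_ == _); ring.
  + exact: ltnW.
Qed.
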